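(* Let $d \ge 1$ be an integer, let $A \subset \mathbb{Z}$ with $|A| = d$, and put $\Omega = A + [0,1]$. Let $\Gamma \subset \mathbb{R}$ be a set of $d$ real numbers, pairwise incongruent modulo $1$, with $0 \in \Gamma$, and suppose that $\Lambda = \Gamma + \mathbb{Z}$ is a spectrum for $\Omega$. Let $r$ be an integer with $1 \le r \le d$ and $r \ge \lfloor d/2 \rfloor$, and suppose that an $r \times (d-r+1)$ flag is contained in $(A - A) \setminus \{0\}$, i.e. there exist integers $m$ and $N$ with $N > r$ such that $\{ m + nN + i : 0 \le n \le d-r,\ 1 \le i \le r \} \subset (A - A) \setminus \{0\}$. Then $\Lambda$ is rational, that is, $\Lambda \subset \mathbb{Q}$.
   Context: For $\Omega = A + [0,1]$ with $A\subset\mathbb{Z}$, $|A| = d$ (so $\Omega$ has Lebesgue measure $d$), a set $\Lambda \subset \mathbb{R}$ is a spectrum for $\Omega$ if $\{ \frac{1}{\sqrt{d}} e^{2\pi i \lambda x}|_{\Omega} : \lambda \in \Lambda \}$ is an orthonormal basis of $L^2(\Omega)$. $A - A = \{a - a' : a, a' \in A\}$. For integers $m$, $r \ge 1$, $s \ge 1$ and $N > r$, the $r \times s$ flag with parameters $m$ and $N$ is the set $\bigcup_{n=0}^{s-1} S_n$, where $S_0 = \{m+1, m+2, \dots, m+r\}$ and $S_n = S_{n-1} + N$ for $1 \le n \le s-1$. *)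

(* Defs.v *)
From mathcomp Require Import all_boot all_order all_algebra.
From mathcomp Require Import finmap.
From mathcomp Require Import all_classical all_reals all_analysis.
From mathcomp Require Import complex.

Set Implicit Arguments.
Unset Strict Implicit.
Unset Printing Implicit Defensive.
Import Order.TTheory GRing.Theory Num.Theory.

Local Open Scope classical_set_scope.
Local Open Scope ring_scope.
Local Open Scope complex_scope.

Section complex_L2.
Context {R : realType}.
Local Notation mu := (@lebesgue_measure R).

Definition Cintegral (D : set R) (f : R -> R[i]) : R[i] :=
  (\int[mu]_(x in D) complex.Re (f x)) +i* (\int[mu]_(x in D) complex.Im (f x)).

(* The square of the L^2(D) norm; it may be +oo. *)
Definition L2sqnorm (D : set R) (f : R -> R[i]) : \bar R :=
  (\int[mu]_(x in D) (Normc.normc (f x) ^+ 2)%:E)%E.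

(* Elements of L^2(D) are represented by functions on the whole line, of which
   only the restriction to D matters; they are never compared by Leibniz
   equality, only through integrals over D. *)
Definition inL2 (D : set R) (f : R -> R[i]) : Prop :=
  [/\ measurable_fun D (fun x => complex.Re (f x)),
      measurable_fun D (fun x => complex.Im (f x))
    & (L2sqnorm D f < +oo)%E].

Definition L2inner (D : set R) (f g : R -> R[i]) : R[i] :=
  Cintegral D (fun x => f x * conjc (g x)).

Definition orthonormal_family (I : choiceType) (L : set I) (D : set R)
    (e : I -> R -> R[i]) : Prop :=
  (forall i, L i -> inL2 D (e i)) /\
  (forall i j, L i -> L j -> L2inner D (e i) (e j) = (i == j)%:R).

Definition dense_span (I : choiceType) (L : set I) (D : set R)
    (e : I -> R -> R[i]) : Prop :=
  forall f : R -> R[i], inL2 D f -> forall eps : R, 0 < eps ->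
    exists (s : seq I) (c : I -> R[i]),
      (forall i, i \in s -> L i) /\
      (L2sqnorm D (fun x => f x - \sum_(i <- s) c i * e i x)%R
         < (eps ^+ 2)%:E)%E.

Definition orthonormal_basis (I : choiceType) (L : set I) (D : set R)
    (e : I -> R -> R[i]) : Prop :=
  orthonormal_family L D e /\ dense_span L D e.

Definition expi (t : R) : R[i] := cos t +i* sin t.

Definition is_spectrum (d : nat) (Omega Lambda : set R) : Prop :=
  orthonormal_basis Lambda Omega
    (fun lambda x => ((Num.sqrt d%:R)^-1)%:C * expi (2 * pi * lambda * x)).

Definition plus_unit_interval (A : {fset int}) : set R :=
  [set a%:~R + t | a in [set` A] & t in `[0, 1]].

Definition plus_integers (Gamma : {fset R}) : set R :=
  [set g + k%:~R | g in [set` Gamma] & k in [set: int]].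

Definition congr_mod1 (x y : R) : Prop := exists k : int, x - y = k%:~R.

End complex_L2.

Definition difference_set (A : {fset int}) : set int :=
  [set a - a' | a in [set` A] & a' in [set` A]].

Fixpoint flag_row (r : nat) (m N : int) (n : nat) : set int :=
  if n is n'.+1 then [set z + N | z in flag_row r m N n']
  else [set m + i%:Z | i in [set i : nat | (1 <= i <= r)%N]].

Definition flag (r s : nat) (m N : int) : set int :=
  \bigcup_(n < s) flag_row r m N n.

(* Main.v *)
Require Import Defs.
From mathcomp Require Import all_boot all_order all_algebra.
From mathcomp Require Import finmap.
From mathcomp Require Import all_classical all_reals all_analysis.
From mathcomp Require Import complex.
From mathcomp Require Import measurable_realfun.
From mathcomp Require Import zify ring lra.

(** Write e(t) for exp(2 i pi t), and let g_1, ..., g_d be the elements of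
    Gamma and a_1, ..., a_d those of A.

    Integrating over the unit intervals that make up Omega, the orthogonality
    of two exponentials whose frequencies x and y are incongruent modulo 1
    amounts to the vanishing of the sum of e((x - y) a) over a in A: the
    integral over [a, a + 1] is e((x - y) a) times a nonzero factor that does
    not depend on a (exponential_sum_eq0).  Hence the d x d matrix
    (e(g_i a_k)) is sqrt d times a unitary matrix, and its columns are
    orthogonal as well as its rows: the points z_i = e(g_i), which are distinct
    because the g_i are incongruent, satisfy sum_i z_i ^ n = 0 for every
    nonzero n in A - A (dual_exponential_sum_eq0).

    On the flag these relations read
      sum_i c_i w_i ^ n z_i ^ k = 0   for 0 <= n <= d - r, 0 <= k < r,
    with w_i = z_i ^ N and nonzero weights c_i = z_i ^ (m + 1).  So the weights
    annihilate every product P(w) Q(z) with deg P <= d - r and deg Q < r.  If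
    at most r of the indices shared the value w_j, at least d - r indices would
    have another value of w; a P of degree d - r could then vanish at d - r of
    these without vanishing at w_j, and a Q of degree r - 1 could vanish at the
    remaining r - 1 points z_i other than z_j, leaving the single nonzero term
    of index j.  So every fiber of w has more than r elements (fiber_card_gt),
    and 2 (r + 1) > d leaves room for only one fiber.  Since 0 is in Gamma,
    that fiber is w = 1: every z_i is an N-th root of unity, that is, N g_i is
    an integer. *)

Set Implicit Arguments.
Unset Strict Implicit.
Unset Printing Implicit Defensive.
Import Order.TTheory GRing.Theory Num.Theory.
Import numFieldNormedType.Exports.

Local Open Scope ring_scope.

(** * Fibers of a function under vanishing moments *)

Lemma exists_subset_card (T : finType) (B : {set T}) (k : nat) :
  (k <= #|B|)%N -> exists S : {set T}, S \subset B /\ #|S| = k.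
Proof.
move=> kB; exists [set x in take k (enum B)]; split.
  by apply/fintype.subsetP => x; rewrite inE => /mem_take; rewrite mem_enum.
rewrite cardsE; have /card_uniqP -> : uniq (take k (enum B)).
  by rewrite take_uniq // enum_uniq.
by rewrite size_takel // -cardE.
Qed.

(** Each product P(w) Q(z) of polynomials of bounded degree is a linear
    combination of the monomials w ^ n z ^ i, so the weights c annihilate it. *)
Lemma sum_horner_eq0 (F : fieldType) (I : finType) (z w c : I -> F)
    (s r : nat) :
  (forall n i : nat, (n < s)%N -> (i < r)%N ->
     \sum_j c j * w j ^+ n * z j ^+ i = 0) ->
  forall P Q : {poly F}, (size P <= s)%N -> (size Q <= r)%N ->
  \sum_j c j * P.[w j] * Q.[z j] = 0.
Proof.
move=> h P Q sP sQ.
under eq_bigr => j _.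
  rewrite (horner_coef_wide _ sP) (horner_coef_wide _ sQ) -mulrA big_distrlr /=.
  rewrite mulr_sumr; under eq_bigr => n _ do rewrite mulr_sumr.
  over.
rewrite exchange_big big1 //= => n _; rewrite exchange_big big1 //= => i _.
transitivity (P`_n * Q`_i * \sum_j c j * w j ^+ n * z j ^+ i).
  by rewrite mulr_sumr; apply: eq_bigr => j _; ring.
by rewrite h // mulr0.
Qed.

(** If the fiber of w through j had at most r elements, then #|I| - r of the
    indices outside it could be killed by a polynomial in w, and the other
    r - 1 indices besides j by a polynomial in z; the resulting product would
    be nonzero at j only, although the weights annihilate it. *)
Lemma fiber_card_gt (F : fieldType) (I : finType) (z w c : I -> F) (r : nat) :
  injective z -> (r <= #|I|)%N ->
  (forall n i : nat, (n < (#|I| - r).+1)%N -> (i < r)%N ->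
     \sum_j c j * w j ^+ n * z j ^+ i = 0) ->
  forall j, c j != 0 -> (r < #|[set k | w k == w j]|)%N.
Proof.
move=> z_inj rI h j cj; rewrite ltnNge; apply/negP => fib_le.
have rpos : (0 < r)%N.
  by apply: leq_trans fib_le; apply/card_gt0P; exists j; rewrite inE.
set B := [set k | w k != w j].
have [S [SB cS]] : exists S : {set I}, S \subset B /\ #|S| = (#|I| - r)%N.
  apply: exists_subset_card.
  have -> : B = ~: [set k | w k == w j] by apply/setP => k; rewrite !inE.
  by rewrite -(cardsC [set k | w k == w j]); lia.
have jS : j \notin S.
  by apply/negP => /(fintype.subsetP SB); rewrite inE eqxx.
(* The point j is the only common non-zero of P(w) and Q(z). *)
pose P := \prod_(k in S) ('X - (w k)%:P).
pose Q := \prod_(k in ~: S :\ j) ('X - (z k)%:P).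
have sP : (size P <= (#|I| - r).+1)%N
  by rewrite /P -big_enum size_prod_XsubC -cardE cS.
have sQ : (size Q <= r)%N.
  rewrite /Q -big_enum size_prod_XsubC -cardE.
  have := cardsC S; rewrite (cardsD1 j (~: S)) inE jS cS; lia.
have := sum_horner_eq0 h sP sQ.
rewrite (bigD1 j) //= big1 ?addr0 => [/eqP|k kj]; last first.
  case: (boolP (k \in S)) => kS.
    suff -> : P.[w k] = 0 by rewrite mulr0 mul0r.
    by apply/eqP; rewrite horner_prod prodf_seq_eq0; apply/hasP; exists k;
      rewrite ?mem_index_enum ?kS ?hornerXsubC ?subrr /=.
  suff -> : Q.[z k] = 0 by rewrite mulr0.
  apply/eqP; rewrite horner_prod prodf_seq_eq0; apply/hasP; exists k.
    exact: mem_index_enum.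
  by rewrite !inE kj kS hornerXsubC subrr /=.
rewrite !mulf_eq0 (negPf cj) /= !horner_prod => /orP[] /prodf_eq0 [k kS];
  rewrite hornerXsubC subr_eq0 => /eqP e.
  by move/(fintype.subsetP SB): kS; rewrite inE e eqxx.
by move: kS; rewrite (z_inj _ _ e) !inE eqxx.
Qed.

(** * The exponential on the unit circle *)

Section expi_theory.
Context {R : realType}.
Implicit Types s t : R.
Local Open Scope complex_scope.

Lemma expi0 : expi (0 : R) = 1.
Proof. by rewrite /expi cos0 sin0. Qed.

Lemma expiD s t : expi (s + t) = expi s * expi t.
Proof.
by rewrite /expi cosD sinD; simpc; rewrite [sin s * _ + _]addrC.
Qed.

Lemma expi_conj t : conjc (expi t) = expi (- t).
Proof. by rewrite /expi cosN sinN. Qed.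

Lemma expi_neq0 t : expi t != 0.
Proof.
by apply/eqP => e; have := expiD t (- t); rewrite subrr expi0 e mul0r => /eqP;
  rewrite oner_eq0.
Qed.

Lemma expiX t n : expi t ^+ n = expi (t * n%:R).
Proof.
elim: n => [|n IH]; first by rewrite expr0 mulr0 expi0.
by rewrite exprS IH -expiD -natr1; congr expi; ring.
Qed.

Lemma expi_int (k : int) : expi (2 * pi * k%:~R : R) = 1.
Proof.
have H (n : nat) : expi (2 * pi * n%:R : R) = 1.
  by rewrite -expiX (_ : 2 * pi = pi *+ 2 :> R) ?mulr_natl //
     /expi cos2pi sin2pi expr1n.
case: k => n; first exact: H.
rewrite NegzE mulrNz mulrN -expi_conj H.
by rewrite /conjc; congr (_ +i* _); rewrite oppr0.
Qed.

(** The kernel of t |-> expi (2 pi t) is the ring of integers: for the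
    fractional part y of t, cos (2 pi y) = 1 forces sin (pi y) = 0, whereas
    sin is positive on ]0, pi[. *)
Lemma expi_eq1 t : expi (2 * pi * t) = 1 -> exists k : int, t = k%:~R.
Proof.
move=> e; exists (Num.floor t).
pose y := t - (Num.floor t)%:~R.
have y0 : 0 <= y by rewrite subr_ge0 floor_le.
have y1 : y < 1 by rewrite ltrBlDl; have := floorD1_gt t; rewrite intrD.
have : expi (2 * pi * y) = 1.
  rewrite /y mulrBr expiD e mul1r -expi_conj expi_int.
  by rewrite /conjc; congr (_ +i* _); rewrite oppr0.
case => c1 _; apply/eqP; rewrite -subr_eq0 -/y; apply/negP => /negP yn0.
have ypos : 0 < y by rewrite lt_neqAle eq_sym yn0.
have pp : 0 < pi :> R by exact: pi_gt0.
have := @sin_gt0_pi R (pi * y).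
rewrite mulr_gt0 //= gtr_pMr // => /(_ y1).
have := cos_mulr2n (pi * y).
rewrite (_ : (pi * y) *+ 2 = 2 * pi * y) ?c1; last by ring.
have := cos2Dsin2 (pi * y); nra.
Qed.

End expi_theory.

(** * Integration over a union of unit intervals *)

Local Open Scope classical_set_scope.
Local Open Scope ring_scope.

Section integration.
Context {R : realType}.
Local Notation mu := (@lebesgue_measure R).
Implicit Types (A : {fset int}) (F f : R -> R).

Lemma plus_unit_intervalE A : plus_unit_interval A =
  \big[setU/set0]_(a <- A) `[a%:~R, (a%:~R + 1 : R)]%classic.
Proof.
rewrite -bigcup_seq; apply/seteqP; split => x.
  move=> [a aA [t /= t01 <-]]; exists a => //=.
  by move: t01; rewrite !in_itv /=; lra.
move=> [a aA /= xa]; exists a => //.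
exists (x - a%:~R); last by rewrite /= addrC subrK.
by move: xa; rewrite /= !in_itv /=; lra.
Qed.

Lemma compact_plus_unit_interval A : compact (plus_unit_interval A : set R).
Proof.
by rewrite plus_unit_intervalE; apply: bigsetU_compact => a _;
  exact: segment_compact.
Qed.

Lemma integrable_plus_unit_interval A f : continuous f ->
  mu.-integrable (plus_unit_interval A) (EFin \o f).
Proof.
move=> cf; apply: continuous_compact_integrable.
  exact: compact_plus_unit_interval.
by apply: continuous_subspaceT.
Qed.

Lemma integral_derive F f (a b : R) : a < b -> continuous f ->
  (forall x : R, is_derive x 1 F (f x)) ->
  (\int[mu]_(x in `[a, b[) (f x)%:E)%E = (F b - F a)%:E.
Proof.
move=> ab cf dF.
have mf : measurable_fun [set: R] f by exact: continuous_measurable_fun.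
rewrite integral_itv_bndo_bndc; last first.
  by apply/measurable_EFinP; apply: measurable_funTS.
have cF x : {for x, continuous F}.
  apply: differentiable_continuous; apply/derivable1_diffP.
  by have := dF x; case.
rewrite (@continuous_FTC2 _ f F) //.
- exact: continuous_subspaceT.
- split.
  + by move=> x _; have := dF x; case.
  + by apply: cvg_at_right_filter; exact: cF.
  + by apply: cvg_at_left_filter; exact: cF.
- by move=> x _; rewrite derive1E; have := dF x; case.
Qed.

(** Adjacent closed unit intervals share an endpoint; the half-open ones
    `[a, a + 1[ are disjoint, and their union misses only finitely many points
    of the domain. *)
Lemma Rintegral_plus_unit_interval A F f : continuous f ->
  (forall x : R, is_derive x 1 F (f x)) ->
  \int[mu]_(x in plus_unit_interval A) f x =
  \sum_(a <- A) (F (a%:~R + 1) - F a%:~R).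
Proof.
move=> cf dF; rewrite /Rintegral.
pose N : set R := [set a%:~R + 1 | a in [set` A]].
pose I (a : int) : set R := `[a%:~R, (a%:~R + 1)[%classic.
pose D := \big[setU/set0]_(a <- A) I a.
have mf : measurable_fun [set: R] f by exact: continuous_measurable_fun.
have cN : countable N.
  by apply: finite_set_countable; apply: finite_image; exact: finite_fset.
have mI a : measurable (I a) by exact: measurable_itv.
have mD : measurable D by exact: bigsetU_measurable.
have mO : measurable (plus_unit_interval A : set R).
  by apply: compact_measurable; exact: compact_plus_unit_interval.
have DO : D `<=` plus_unit_interval A.
  rewrite plus_unit_intervalE /D -!bigcup_seq => x [a aA xa]; exists a => //.
  by move: xa; rewrite /I /= !in_itv /= => /andP[-> /ltW].
have mOD : measurable (plus_unit_interval A `\` D) by exact: measurableD.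
have N0 : mu (plus_unit_interval A `\` D) = 0%E.
  apply: countable_lebesgue_measure0; apply: sub_countable cN.
  apply: subset_card_le => x [[a aA [t t01 <-]] nD]; exists a => //.
  congr (_ + _); apply/esym/eqP/negPn/negP => t1; apply: nD.
  rewrite /D -bigcup_seq; exists a => //; move: t01.
  rewrite /I /= !in_itv /= => t01.
  have : t < 1 by rewrite lt_neqAle t1; case/andP: t01.
  lra.
have -> : (\int[mu]_(x in plus_unit_interval A) (f x)%:E =
    \int[mu]_(x in plus_unit_interval A `\` (plus_unit_interval A `\` D))
      (f x)%:E)%E.
  by apply: negligible_integral => //; exact: integrable_plus_unit_interval.
rewrite setDD setIidr // integral_bigsetU_EFin //; last first.
- by apply/measurable_EFinP; apply: measurable_funTS.
- apply/trivIsetP => i j _ _ /eqP ij; apply/seteqP; split => // x [].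
  rewrite /I /= !in_itv /= => xi xj; apply: ij.
  (* Both integers are the integer part of a common point. *)
  have fl k : k%:~R <= x < k%:~R + 1 -> Num.floor x = k.
    by move=> h; apply/eqP; rewrite floor_eq intrD.
  by rewrite -(fl i) // -(fl j).
under eq_bigr => a _ do rewrite (integral_derive _ cf dF) ?ltrDl //.
by rewrite sumEFin.
Qed.

End integration.

(** * Orthogonality of exponentials as exponential sums *)

Section exponential_sums.
Context {R : realType}.
Local Open Scope complex_scope.
Implicit Types (A : {fset int}) (k t u : R).

Lemma sum_complexE (I : Type) (s : seq I) (f g : I -> R) :
  \sum_(i <- s) (f i +i* g i) = (\sum_(i <- s) f i) +i* (\sum_(i <- s) g i).
Proof.
elim: s => [|i s IH]; first by rewrite !big_nil.
by rewrite !big_cons IH; simpc.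
Qed.

Lemma is_derive_scale_comp (g g' : R -> R) k u (x : R) :
  (forall y : R, is_derive y 1 g (g' y)) ->
  is_derive x 1 (fun y : R => k * g (u * y)) (k * (g' (u * x) * u)).
Proof.
move=> dg; apply: (is_deriveZ k (f := g \o ( *%R u))).
apply: is_derive1_comp.
apply: is_derive_eq; exact: mulr1.
Qed.

Lemma is_derive_sin_scale k u (x : R) : u != 0 ->
  is_derive x 1 (fun y : R => k / u * sin (u * y)) (k * cos (u * x)).
Proof.
move=> u0; apply: (is_derive_eq
  (is_derive_scale_comp (k / u) u x (@is_derive_sin R))).
by field.
Qed.

Lemma is_derive_cos_scale k u (x : R) : u != 0 ->
  is_derive x 1 (fun y : R => - (k / u) * cos (u * y)) (k * sin (u * x)).
Proof.
move=> u0; apply: (is_derive_eq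
  (is_derive_scale_comp (- (k / u)) u x (@is_derive_cos R))).
by field.
Qed.

Lemma continuous_scale_comp (f : R -> R) k u : continuous f ->
  continuous (fun x : R => k * f (u * x)).
Proof.
move=> cf x; apply: cvgMr.
apply: (@continuous_comp _ _ _ (fun y : R => u * y) f).
  by apply: cvgMr; exact: cvg_id.
exact: cf.
Qed.

(** The primitive of k * expi (u x) is (k / (i u)) * expi (u x), and its
    increment over [a, a + 1] is (k / (i u)) * (expi u - 1) * expi (u a), since
    1 / i = - i.  Real and imaginary parts are integrated separately. *)
Lemma Cintegral_expi A k u : u != 0 ->
  Cintegral (plus_unit_interval A) (fun x => k%:C * expi (u * x)) =
  (0 +i* - (k / u)) * (expi u - 1) * \sum_(a <- A) expi (u * a%:~R).
Proof.
move=> u0; rewrite /Cintegral.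
have cc := @continuous_scale_comp cos k u (@continuous_cos R).
have cs := @continuous_scale_comp sin k u (@continuous_sin R).
rewrite (_ : (fun x => complex.Re _) = (fun x => k * cos (u * x))); last first.
  by apply/funext => x; rewrite /expi; simpc.
rewrite (_ : (fun x => complex.Im _) = (fun x => k * sin (u * x))); last first.
  by apply/funext => x; rewrite /expi; simpc.
rewrite (Rintegral_plus_unit_interval A cc
  (fun x => is_derive_sin_scale k x u0)).
rewrite (Rintegral_plus_unit_interval A cs
  (fun x => is_derive_cos_scale k x u0)).
rewrite -sum_complexE mulr_sumr; apply: eq_bigr => a _.
rewrite -[RHS]mulrA mulrBl mul1r -expiD /expi; simpc.
rewrite (_ : u + u * a%:~R = u * (a%:~R + 1)); last by ring.
by congr (_ +i* _); ring.
Qed.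

(** The factor expi (2 pi (x - y)) - 1 in the integral is nonzero precisely
    because x and y are incongruent modulo 1, which leaves the sum over A. *)
Lemma exponential_sum_eq0 (d : nat) A (x y : R) : (0 < d)%N ->
  ~ congr_mod1 x y ->
  L2inner (plus_unit_interval A)
    (fun z => (Num.sqrt d%:R)^-1%:C * expi (2 * pi * x * z))
    (fun z => (Num.sqrt d%:R)^-1%:C * expi (2 * pi * y * z)) = 0 ->
  \sum_(a <- A) expi (2 * pi * (x - y) * a%:~R) = 0.
Proof.
move=> d0 nxy; set c := (Num.sqrt d%:R)^-1; rewrite /L2inner.
have xy0 : x - y != 0.
  by apply/eqP => e; apply: nxy; exists 0.
have u0 : 2 * pi * (x - y) != 0.
  by rewrite !mulf_neq0 // ?pnatr_eq0 // gt_eqF // pi_gt0.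
rewrite (_ : (fun z => _) =
    (fun z => (c * c)%:C * expi (2 * pi * (x - y) * z))); last first.
  apply/funext => z.
  rewrite (_ : 2 * pi * (x - y) * z = 2 * pi * x * z + - (2 * pi * y * z));
    last by ring.
  rewrite expiD /expi cosN sinN; simpc.
  by congr (_ +i* _); ring.
rewrite Cintegral_expi // => /eqP; rewrite !mulf_eq0 => /orP[/orP[]|/eqP //].
  have c0 : c != 0 by rewrite invr_eq0 sqrtr_eq0 -ltNge ltr0n.
  have /negPf cu0 : - (c * c / (2 * pi * (x - y))) != 0.
    by rewrite oppr_eq0 !mulf_neq0 // invr_eq0.
  by rewrite eq_complex /= cu0 andbF.
by rewrite subr_eq0 => /eqP /expi_eq1 /nxy.
Qed.

End exponential_sums.

(** * Duality and the points of the flag *)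

Section duality.
Context {R : realType}.
Local Open Scope complex_scope.

(** A square matrix with pairwise orthogonal rows of squared norm d is, up to
    the factor sqrt d, unitary, so its columns are orthogonal too; this is the
    fact that a one-sided inverse of a square matrix is two-sided. *)
Lemma dual_exponential_sum_eq0 (d : nat) (a : 'I_d -> int) (g : 'I_d -> R) :
  (forall i j, i != j -> \sum_k expi (2 * pi * (g i - g j) * (a k)%:~R) = 0) ->
  forall k l, k != l -> \sum_i expi (2 * pi * g i * (a k - a l)%:~R) = 0.
Proof.
move=> orth k l kl.
have d0 : d%:R != 0 :> R[i].
  by rewrite pnatr_eq0 -lt0n; apply: leq_trans (ltn_ord k).
pose U := \matrix_(i < d, k < d) expi (2 * pi * g i * (a k)%:~R).
pose V := \matrix_(k < d, j < d)
  (d%:R^-1 * expi (- (2 * pi * g j * (a k)%:~R))).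
have UV : U *m V = 1%:M.
  apply/matrixP => i j; rewrite !mxE.
  transitivity (d%:R^-1 * \sum_k expi (2 * pi * (g i - g j) * (a k)%:~R)).
    rewrite mulr_sumr; apply: eq_bigr => m _; rewrite !mxE mulrCA -expiD.
    by congr (_ * expi _); ring.
  case: eqVneq => [->|/orth ->]; last by rewrite mulr0.
  rewrite (eq_bigr (fun=> 1)); last first.
    by move=> m _; rewrite subrr mulr0 mul0r expi0.
  by rewrite sumr_const card_ord mulVf.
have /matrixP/(_ l k) := mulmx1C UV.
rewrite !mxE eq_sym (negPf kl) /=.
under eq_bigr => i _ do rewrite !mxE -(mulrA d%:R^-1) -expiD.
rewrite -mulr_sumr => /eqP; rewrite mulf_eq0 invr_eq0 (negPf d0) /= => /eqP e.
by rewrite -[RHS]e; apply: eq_bigr => i _; congr expi; rewrite intrB; ring.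
Qed.

End duality.

(** Enumerating A and Gamma by the same index type turns the exponentials
    into the entries of a square matrix. *)
Lemma fset_ord_enum (K : choiceType) (A : {fset K}) (d : nat) : #|` A| = d ->
  exists f : 'I_d -> K, [/\ injective f, forall i, f i \in A,
    forall x, x \in A -> exists i, x = f i
  & forall (V : nmodType) (h : K -> V), \sum_(x <- A) h x = \sum_i h (f i)].
Proof.
move=> <-; exists (tnth (in_tuple A)); split.
- by apply/tuple_uniqP; exact: fset_uniq.
- by move=> i; exact: mem_tnth.
- by move=> x /(tnthP (in_tuple A)).
- by move=> V h; exact: (big_tnth _ _ A xpredT).
Qed.

(** The shift i.+1 accounts for rows of a flag starting at m + 1. *)
Lemma mem_flag (r s : nat) (m N : int) (n i : nat) :
  (n < s)%N -> (i < r)%N -> flag r s m N (m + N *+ n + i.+1%:Z).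
Proof.
move=> ns ir; exists n => //; elim: n {ns} => [|n IH] /=.
  by exists i.+1 => //; rewrite mulr0n addr0.
by exists (m + N *+ n + i.+1%:Z) => //; rewrite mulrSr; ring.
Qed.

Theorem theorem7 (R : realType) (d : nat) (A : {fset int}) (Gamma : {fset R})
    (r : nat)
    (d_ge1 : (1 <= d)%N)
    (cardA : #|` A| = d)
    (cardGamma : #|` Gamma| = d)
    (Gamma_incongr : forall x y : R, x \in Gamma -> y \in Gamma ->
       x <> y -> ~ congr_mod1 x y)
    (Gamma0 : 0 \in Gamma)
    (Lambda_spectrum :
       is_spectrum d (plus_unit_interval A) (plus_integers Gamma))
    (r_bounds : (1 <= r <= d)%N)
    (r_half : (d %/ 2 <= r)%N)
    (flag_in_diff : exists m N : int, r%:Z < N /\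
       flag r (d - r + 1)%N m N `<=` difference_set A `\ 0) :
  plus_integers Gamma `<=` range (ratr : rat -> R).
Proof.
have [a [a_inj a_in a_surj a_sum]] := fset_ord_enum cardA.
have [g [g_inj g_in g_surj _]] := fset_ord_enum cardGamma.
have [[_ Lorth] _] := Lambda_spectrum.
have Lg i : plus_integers Gamma (g i).
  by exists (g i); [exact: g_in|exists 0 => //; rewrite addr0].
have orth i j : i != j ->
    \sum_k expi (2 * pi * (g i - g j) * (a k)%:~R) = 0.
  move=> ij; have gij : g i <> g j by move/g_inj/eqP; rewrite (negPf ij).
  have := Lorth _ _ (Lg i) (Lg j); rewrite (negPf (introN eqP gij)).
  move/(exponential_sum_eq0 d_ge1 (Gamma_incongr _ _ (g_in i) (g_in j) gij)).
  by rewrite a_sum.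
have vanish n : difference_set A n -> n <> 0 ->
    \sum_i expi (2 * pi * g i * n%:~R) = 0.
  move=> [x /a_surj [k ->] [y /a_surj [l ->] <-]] kl.
  apply: dual_exponential_sum_eq0 => //.
  by apply/eqP => e; apply: kl; rewrite e subrr.
have [m [N [rN flagA]]] := flag_in_diff.
(* As N > r >= 0, powers of z with natural exponents are enough. *)
have {rN} [M [M0 NM]] : exists M : nat, (0 < M)%N /\ N = M.
  by exists `|N|%N; split; lia.
pose z i : R[i] := expi (2 * pi * g i).
pose c i : R[i] := expi (2 * pi * g i * (m + 1)%:~R).
have z_inj : injective z.
  move=> i j zij; apply/eqP/negPn/negP => ij.
  apply: (Gamma_incongr _ _ (g_in i) (g_in j)).
    by move/g_inj/eqP; rewrite (negPf ij).
  apply: expi_eq1; rewrite mulrBr expiD -/(z i) zij -expiD subrr.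
  exact: expi0.
have fib j : (r < #|[set k | z k ^+ M == z j ^+ M]%SET|)%N.
  case/andP: r_bounds => _ rd.
  apply: (fiber_card_gt (c := c) (w := fun k => z k ^+ M) z_inj);
    rewrite ?card_ord //; last exact: expi_neq0.
  move=> n i nd ir.
  have nd' : (n < d - r + 1)%N by rewrite addn1.
  have [dA n0] := flagA _ (mem_flag m N nd' ir).
  rewrite -[RHS](vanish _ dA n0); apply: eq_bigr => k _.
  rewrite /c /z -exprM !expiX -!expiD NM; congr expi.
  have -> : (m + M%:Z *+ n + i.+1%:Z)%:~R =
      m%:~R + M%:R * n%:R + (i%:R + 1) :> R.
    rewrite -natrM natr1 (_ : M%:Z *+ n = (M * n)%:Z) ?intrD //.
    by rewrite -mulr_natr natz PoszM.
  by rewrite intrD natrM; ring.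
have [i0 g0] := g_surj _ Gamma0.
have zM j : z j ^+ M = 1.
  have z0 : z i0 ^+ M = 1 by rewrite /z -g0 mulr0 expi0 expr1n.
  apply/eqP/negPn/negP => zj.
  (* Two distinct fibers, each with more than r elements, would not fit in
     d <= 2 r + 1 indices. *)
  set B0 := [set k | z k ^+ M == z i0 ^+ M]%SET.
  set Bj := [set k | z k ^+ M == z j ^+ M]%SET.
  have dis : Bj \subset (~: B0)%SET.
    apply/fintype.subsetP => k; rewrite !inE => /eqP ->.
    by rewrite z0.
  have := subset_leq_card dis; have := cardsC B0; rewrite card_ord.
  have := fib i0; have := fib j; rewrite -/B0 -/Bj; lia.
(* The number e(g_j M) = 1 makes g_j M an integer l. *)
move=> x [y /g_surj [j ->] [k _ <-]].
have := zM j; rewrite /z expiX -mulrA => /expi_eq1 [l gl].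
exists (l%:~R / M%:R + k%:~R) => //.
rewrite rmorphD fmorph_div /= !ratr_int ratr_nat -gl mulfK //.
by rewrite pnatr_eq0 -lt0n.
Qed.
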